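(* If $m$ is a non-negative integer, then \[ \sum_{n=1}^\infty \frac{2^{2n}}{n^2\binom{2(n+m)}{n+m}\binom{n+m}{m}}=\frac{1}{\binom{2m}{m}}\left(3\zeta(2)-4O_m^{(2)}\right). \] In particular, \[ \sum_{n=1}^\infty \frac{2^{2n}}{n^2\binom{2n}{n}}=\frac{\pi^2}{2}. \]
   Context: $\zeta$ is the Riemann zeta function. For a nonnegative integer $m$ and positive integer $r$, $O_m^{(r)}=\sum_{j=1}^m \frac{1}{(2j-1)^r}$ (empty sum $=0$). *)

(* Defs.v *)
From Stdlib Require Import Reals.
From Coquelicot Require Import Coquelicot.
Open Scope R_scope.

Definition is_series_from1 (a : nat -> R) (l : R) : Prop :=
  is_series (fun k : nat => a (S k)) l.

(* The Dirichlet series of the Riemann zeta function at a real argument; it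
   represents zeta only for 1 < s, where it converges. *)
Definition zeta (s : R) : R :=
  Series (fun k : nat => / Rpower (INR (S k)) s).

(* O_m^(r); [sum_n_m _ 1 0] is the empty sum. *)
Definition odd_harmonic (r m : nat) : R :=
  sum_n_m (fun j : nat => 1 / (2 * INR j - 1) ^ r) 1 m.

(* Main.v *)
(** Put x = m + 1/2.  Up to the factor binom(2m, m), the n-th summand is
    (n-1)! / (n (x)_n), whose sum f(x) satisfies f(x) - f(x+1) = 1/x^2 because
    the difference telescopes in n.  Iterating in x gives
    f(x) = sum_j 1/(x+j)^2 = 4 sum_(j>=m) 1/(2j+1)^2; at the level of partial sums the
    error is controlled by the factor prod_(j<=n) j/(x+j), which decreases in x and
    tends to 0 in n.  It remains to know that the odd reciprocal squares
    sum to pi^2/8: the points (2k+1) pi / 2^(n+2), k < 2^n, satisfy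
    sum 1/sin^2 = 2 * 4^n by the half-angle identity
    1/sin^2(x/2) + 1/cos^2(x/2) = 4/sin^2 x, and 1/x^2 <= 1/sin^2 x <= 1 + 1/x^2. *)

Require Import Defs.
From Stdlib Require Import Reals Lra Lia.
From Coquelicot Require Import Coquelicot.
Open Scope R_scope.

(** * Finite sums and their link to series *)

(* [psum a n] is the sum of the first [n] terms, unlike Coquelicot's [sum_n a n]. *)
Fixpoint psum (a : nat -> R) (n : nat) : R :=
  match n with O => 0 | S n' => psum a n' + a n' end.

Lemma psum_S (a : nat -> R) (n : nat) : psum a (S n) = psum a n + a n.
Proof. reflexivity. Qed.

Lemma sum_n_psum (a : nat -> R) (n : nat) : sum_n a n = psum a (S n).
Proof.
  induction n as [|n IH].
  - rewrite sum_O; simpl; ring.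
  - rewrite sum_Sn, IH; reflexivity.
Qed.

Lemma is_series_psum (a : nat -> R) (l : R) :
  is_series a l <-> is_lim_seq (psum a) l.
Proof.
  rewrite is_lim_seq_incr_1.
  split; intro H.
  - apply is_lim_seq_ext with (sum_n a); [apply sum_n_psum | exact H].
  - apply is_lim_seq_ext with (v := sum_n a) in H; [exact H |].
    intro n; symmetry; apply sum_n_psum.
Qed.

Lemma psum_ext (a b : nat -> R) (n : nat) :
  (forall k, (k < n)%nat -> a k = b k) -> psum a n = psum b n.
Proof.
  induction n as [|n IH]; intro H; simpl; [reflexivity |].
  rewrite IH, H by (intros; try apply H; lia); reflexivity.
Qed.

Lemma psum_le (a b : nat -> R) (n : nat) :
  (forall k, (k < n)%nat -> a k <= b k) -> psum a n <= psum b n.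
Proof.
  induction n as [|n IH]; intro H; simpl; [lra |].
  apply Rplus_le_compat; [apply IH; intros; apply H; lia | apply H; lia].
Qed.

Lemma psum_plus (a b : nat -> R) (n : nat) :
  psum (fun k => a k + b k) n = psum a n + psum b n.
Proof. induction n as [|n IH]; simpl; [ring | rewrite IH; ring]. Qed.

Lemma psum_scal (c : R) (a : nat -> R) (n : nat) :
  psum (fun k => c * a k) n = c * psum a n.
Proof. induction n as [|n IH]; simpl; [ring | rewrite IH; ring]. Qed.

Lemma psum_const (c : R) (n : nat) : psum (fun _ => c) n = INR n * c.
Proof.
  induction n as [|n IH]; [simpl; ring |].
  rewrite psum_S, IH, S_INR; ring.
Qed.

Lemma psum_add (a : nat -> R) (n p : nat) :
  psum a (n + p) = psum a n + psum (fun k => a (n + k)%nat) p.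
Proof.
  induction p as [|p IH]; simpl; [rewrite Nat.add_0_r; ring |].
  rewrite Nat.add_succ_r; simpl; rewrite IH; ring.
Qed.

Lemma psum_rev (a : nat -> R) (n : nat) :
  psum (fun k => a (n - 1 - k)%nat) n = psum a n.
Proof.
  destruct n as [|n]; [reflexivity |].
  rewrite <- !sum_n_psum, !sum_n_Reals, <- (sum_f_R0_skip a).
  apply sum_eq; intros k Hk; f_equal; lia.
Qed.

Lemma psum_nonneg_le (a : nat -> R) (n p : nat) :
  (forall k, 0 <= a k) -> (n <= p)%nat -> psum a n <= psum a p.
Proof. intros H; induction 1 as [|p _ IH]; simpl; [lra | specialize (H p); lra]. Qed.

(** * Bounds and the half-angle identity for the reciprocal squared sine *)

(** The function sin t - t cos t vanishes at 0 and has derivative t sin t, which is nonnegative on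
    [0, x]. *)
Lemma x_cos_le_sin (x : R) : 0 < x < PI / 2 -> x * cos x <= sin x.
Proof.
  intros Hx.
  destruct (MVT_gen (fun t => sin t - t * cos t) 0 x (fun t => t * sin t))
    as [c [Hc E]].
  - intros t _; auto_derive; [exact I | ring].
  - intros t _; apply continuity_pt_filterlim, (ex_derive_continuous (fun t => sin t - t * cos t)).
    auto_derive; exact I.
  - rewrite Rmin_left, Rmax_right in Hc by lra.
    rewrite sin_0 in E.
    assert (0 <= sin c) by (apply sin_ge_0; lra).
    assert (0 <= c * sin c * (x - 0))
      by (repeat apply Rmult_le_pos; lra).
    lra.
Qed.

(** The lower bound is sin x < x; the upper one combines 1/sin^2 = 1 + cot^2 with cot x <= 1/x,
    which is [x_cos_le_sin]. *)
Lemma inv_sin2_bounds (x : R) :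
  0 < x < PI / 2 -> / x ^ 2 <= / sin x ^ 2 <= 1 + / x ^ 2.
Proof.
  intros Hx.
  assert (Hs : 0 < sin x) by (apply sin_gt_0; lra).
  assert (Hc : 0 < cos x) by (apply cos_gt_0; lra).
  assert (H1 := sin_lt_x x (proj1 Hx)).
  assert (H2 := x_cos_le_sin x Hx).
  split.
  - apply Rinv_le_contravar; [apply pow_lt, Hs | apply pow_incr; lra].
  - assert (E : 1 = sin x ^ 2 + cos x ^ 2)
      by (rewrite <- (sin2_cos2 x); unfold Rsqr; ring).
    replace (/ sin x ^ 2) with (1 + (cos x / sin x) ^ 2)
      by (transitivity ((sin x ^ 2 + cos x ^ 2) * / sin x ^ 2);
          [field | rewrite <- E; ring]; lra).
    apply Rplus_le_compat_l.
    rewrite <- pow_inv; apply pow_incr; split.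
    + apply Rlt_le, Rdiv_lt_0_compat; assumption.
    + apply Rmult_le_reg_r with (sin x * x); [apply Rmult_lt_0_compat; lra |].
      field_simplify; lra.
Qed.

(** The cosine of x/2 is written as the sine of PI/2 - x/2 so that, for a node x of one level, both
    arguments are nodes of the next level. *)
Lemma inv_sin2_half (x : R) :
  0 < x < PI / 2 ->
  / sin (x / 2) ^ 2 + / sin (PI / 2 - x / 2) ^ 2 = 4 * / sin x ^ 2.
Proof.
  intros Hx.
  assert (Hs : 0 < sin (x / 2)) by (apply sin_gt_0; lra).
  assert (Hc : 0 < cos (x / 2)) by (apply cos_gt_0; lra).
  rewrite sin_shift.
  replace (sin x) with (2 * sin (x / 2) * cos (x / 2))
    by (rewrite <- sin_2a; f_equal; field).
  assert (E : sin (x / 2) ^ 2 + cos (x / 2) ^ 2 = 1)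
    by (rewrite <- (sin2_cos2 (x / 2)); unfold Rsqr; ring).
  transitivity ((sin (x / 2) ^ 2 + cos (x / 2) ^ 2)
                * / (sin (x / 2) * cos (x / 2)) ^ 2).
  - field; lra.
  - rewrite E; field; lra.
Qed.

(** * The sum of the odd reciprocal squares *)

Definition node (n k : nat) : R := (2 * INR k + 1) * PI / (4 * 2 ^ n).

Lemma node_bounds (n k : nat) : (k < 2 ^ n)%nat -> 0 < node n k < PI / 2.
Proof.
  intros Hk; unfold node.
  assert (Hp : 0 < 2 ^ n) by (apply pow_lt; lra).
  assert (HP := PI_RGT_0).
  assert (Hk' : INR k + 1 <= 2 ^ n).
  { rewrite <- S_INR; change 2 with (INR 2); rewrite <- pow_INR.
    apply le_INR, Hk. }
  assert (H0 := pos_INR k).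
  split.
  - apply Rdiv_lt_0_compat; [apply Rmult_lt_0_compat |]; lra.
  - apply Rmult_lt_reg_r with (4 * 2 ^ n); [lra |].
    field_simplify; [|lra]; nra.
Qed.

(** Half of [node n k] is [node (S n) k], and its reflection in PI/4 is the node of level n+1 with
    index 2^(n+1) - 1 - k. The half-angle identity thus multiplies the sum by 4 at each level. *)
Lemma sum_inv_sin2_node (n : nat) :
  psum (fun k => / sin (node n k) ^ 2) (2 ^ n) = 2 * 4 ^ n.
Proof.
  induction n as [|n IH].
  - simpl; unfold node; simpl.
    replace ((2 * 0 + 1) * PI / (4 * 1)) with (PI / 4) by field.
    rewrite sin_PI4.
    assert (H := sqrt_sqrt 2 ltac:(lra)).
    assert (0 < sqrt 2) by (apply sqrt_lt_R0; lra).
    replace (1 / sqrt 2 * (1 / sqrt 2 * 1)) with (/ (sqrt 2 * sqrt 2))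
      by (field; lra).
    rewrite H; field.
  - replace (2 ^ S n)%nat with (2 ^ n + 2 ^ n)%nat by (simpl; lia).
    rewrite psum_add.
    (* Reversing the upper half of the indices aligns each node with its reflection. *)
    rewrite <- (psum_rev (fun k => / sin (node (S n) (2 ^ n + k)) ^ 2)).
    rewrite <- psum_plus.
    rewrite (psum_ext _ (fun k => 4 * / sin (node n k) ^ 2)).
    + rewrite psum_scal, IH; simpl; ring.
    + intros k Hk.
      assert (Hp : 0 < 2 ^ n) by (apply pow_lt; lra).
      rewrite <- inv_sin2_half by (apply node_bounds, Hk).
      f_equal; do 3 f_equal.
      * unfold node; simpl; field; lra.
      * unfold node.
        rewrite plus_INR, !minus_INR, pow_INR by lia.
        change (INR 2) with 2; simpl; field; lra.
Qed.

(** Each of the 2^n nodes costs at most 1 in the bound 1/sin^2 x <= 1 + 1/x^2. Scaling this total of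
    2^n by PI^2 / (16 * 4^n) gives the error term. *)
Lemma psum_odd_bounds (n : nat) :
  PI ^ 2 / 8 - PI ^ 2 / 16 * (/ 2) ^ n
  <= psum (fun k => / (2 * INR k + 1) ^ 2) (2 ^ n) <= PI ^ 2 / 8.
Proof.
  assert (HP := PI_RGT_0).
  assert (Hp : 0 < 2 ^ n) by (apply pow_lt; lra).
  assert (E4 : 4 ^ n = 2 ^ n * 2 ^ n)
    by (rewrite <- Rpow_mult_distr; f_equal; lra).
  set (s := psum _ _).
  assert (Es : psum (fun k => / node n k ^ 2) (2 ^ n)
               = 16 * 4 ^ n / PI ^ 2 * s).
  { unfold s; rewrite <- psum_scal; apply psum_ext; intros k _.
    assert (H0 := pos_INR k).
    unfold node; rewrite E4; field; lra. }
  assert (Hlo : psum (fun k => / node n k ^ 2) (2 ^ n) <= 2 * 4 ^ n).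
  { rewrite <- sum_inv_sin2_node; apply psum_le; intros k Hk.
    apply inv_sin2_bounds, node_bounds, Hk. }
  assert (Hhi : 2 * 4 ^ n <= 2 ^ n + psum (fun k => / node n k ^ 2) (2 ^ n)).
  { rewrite <- sum_inv_sin2_node.
    replace (2 ^ n) with (psum (fun _ => 1) (2 ^ n))
      by (rewrite psum_const, pow_INR; apply Rmult_1_r).
    rewrite <- psum_plus; apply psum_le; intros k Hk.
    apply inv_sin2_bounds, node_bounds, Hk. }
  rewrite Es in Hlo, Hhi.
  assert (HP2 : 0 < PI ^ 2) by (apply pow_lt, HP).
  assert (Hc : 0 < PI ^ 2 / (16 * 4 ^ n))
    by (apply Rdiv_lt_0_compat; [|rewrite E4]; nra).
  apply (Rmult_le_compat_l _ _ _ (Rlt_le _ _ Hc)) in Hlo, Hhi.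
  rewrite pow_inv.
  replace (PI ^ 2 / (16 * 4 ^ n) * (16 * 4 ^ n / PI ^ 2 * s)) with s in Hlo
    by (rewrite E4; field; lra).
  replace (PI ^ 2 / (16 * 4 ^ n) * (2 ^ n + 16 * 4 ^ n / PI ^ 2 * s))
    with (PI ^ 2 / 16 * / 2 ^ n + s) in Hhi by (rewrite E4; field; lra).
  replace (PI ^ 2 / (16 * 4 ^ n) * (2 * 4 ^ n)) with (PI ^ 2 / 8) in Hlo, Hhi
    by (rewrite E4; field; lra).
  lra.
Qed.

(** The bounds hold only at lengths 2^n: monotonicity yields a limit, and this subsequence
    identifies it. *)
Lemma is_series_inv_odd2 : is_series (fun k => / (2 * INR k + 1) ^ 2) (PI ^ 2 / 8).
Proof.
  apply is_series_psum.
  set (a := fun k => / (2 * INR k + 1) ^ 2).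
  assert (Ha : forall k, 0 <= a k).
  { intro k; apply Rlt_le, Rinv_0_lt_compat, pow_lt.
    assert (H0 := pos_INR k); lra. }
  destruct (ex_finite_lim_seq_incr (psum a) (PI ^ 2 / 8)) as [l Hl].
  - intro n; simpl; specialize (Ha n); lra.
  - intro n; apply Rle_trans with (psum a (2 ^ n)).
    + apply psum_nonneg_le; [exact Ha |].
      apply Nat.lt_le_incl, Nat.pow_gt_lin_r; lia.
    + apply psum_odd_bounds.
  - assert (H2 : is_lim_seq (fun n => psum a (2 ^ n)) l).
    { apply (is_lim_seq_subseq (psum a) l (fun n => (2 ^ n)%nat)); [| exact Hl].
      apply eventually_subseq; intro n; simpl.
      assert (2 ^ n <> 0)%nat by (apply Nat.pow_nonzero; lia); lia. }
    assert (H3 : is_lim_seq (fun n => psum a (2 ^ n)) (PI ^ 2 / 8)).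
    { apply is_lim_seq_le_le with
        (u := fun n => PI ^ 2 / 8 - PI ^ 2 / 16 * (/ 2) ^ n)
        (w := fun _ => PI ^ 2 / 8).
      - intro n; apply psum_odd_bounds.
      - replace (Finite (PI ^ 2 / 8))
          with (Finite (PI ^ 2 / 8 - PI ^ 2 / 16 * 0)) by (f_equal; ring).
        apply is_lim_seq_minus'; [apply is_lim_seq_const |].
        apply (is_lim_seq_scal_l _ _ (Finite 0)), is_lim_seq_geom.
        rewrite Rabs_pos_eq; lra.
      - apply is_lim_seq_const. }
    apply is_lim_seq_unique in H2; apply is_lim_seq_unique in H3.
    replace (PI ^ 2 / 8) with l by congruence; exact Hl.
Qed.

(** * The value of zeta(2) *)

Lemma psum_inv2_double (n : nat) :
  psum (fun k => / INR (S k) ^ 2) (2 * n)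
  = psum (fun k => / (2 * INR k + 1) ^ 2) n
    + / 4 * psum (fun k => / INR (S k) ^ 2) n.
Proof.
  induction n as [|n IH]; [simpl; ring |].
  replace (2 * S n)%nat with (S (S (2 * n))) by lia.
  rewrite !psum_S, IH, !S_INR, mult_INR; change (INR 2) with 2.
  assert (H0 := pos_INR n).
  replace (/ (2 * INR n + 1 + 1) ^ 2) with (/ 4 * / (INR n + 1) ^ 2)
    by (field; lra).
  ring.
Qed.

(** Let S_n and T_n be the partial sums over all and over odd integers. Then S_n <= S_(2n) = T_n +
    S_n/4 bounds S_n by (4/3)(PI^2/8), and in the limit l = PI^2/8 + l/4. *)
Lemma is_series_inv2 : is_series (fun k => / INR (S k) ^ 2) (PI ^ 2 / 6).
Proof.
  apply is_series_psum.
  assert (HO := proj1 (is_series_psum _ _) is_series_inv_odd2).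
  set (h := fun k => / INR (S k) ^ 2).
  assert (Hh : forall k, 0 <= h k).
  { intro k; apply Rlt_le, Rinv_0_lt_compat, pow_lt, lt_0_INR; lia. }
  assert (Ho : forall k, 0 <= / (2 * INR k + 1) ^ 2).
  { intro k; apply Rlt_le, Rinv_0_lt_compat, pow_lt.
    assert (H0 := pos_INR k); lra. }
  destruct (ex_finite_lim_seq_incr (psum h) (PI ^ 2 / 6)) as [l Hl].
  - intro n; simpl; specialize (Hh n); lra.
  - intro n.
    assert (H1 := psum_nonneg_le h n (2 * n) Hh ltac:(lia)).
    unfold h at 2 in H1; rewrite psum_inv2_double in H1; fold h in H1.
    assert (H2 := is_lim_seq_incr_compare _ _ HO ltac:(intro k; simpl; specialize (Ho k); simpl in Ho; lra) n).
    lra.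
  - assert (H2 : is_lim_seq (fun n => psum h (2 * n)) l).
    { apply (is_lim_seq_subseq (psum h) l (fun n => (2 * n)%nat)); [| exact Hl].
      apply eventually_subseq; intro n; lia. }
    assert (H3 : is_lim_seq (fun n => psum h (2 * n)) (PI ^ 2 / 8 + / 4 * l)).
    { eapply is_lim_seq_ext; [intro n; symmetry; apply psum_inv2_double |].
      apply is_lim_seq_plus'; [exact HO |].
      apply (is_lim_seq_scal_l _ _ (Finite l)), Hl. }
    apply is_lim_seq_unique in H2; apply is_lim_seq_unique in H3.
    assert (E : PI ^ 2 / 8 + / 4 * l = l) by congruence.
    replace (PI ^ 2 / 6) with l by lra; exact Hl.
Qed.

Lemma zeta_2 : zeta 2 = PI ^ 2 / 6.
Proof.
  unfold zeta; rewrite <- (is_series_unique _ _ is_series_inv2).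
  apply Series_ext; intro k.
  change 2 with (INR 2) at 1.
  rewrite Rpower_pow; [reflexivity | apply lt_0_INR; lia].
Qed.

(** * The error factor and its decay *)

(** This is n! / (x+1)_n, the reciprocal of the generalized binomial coefficient binom(x+n, n). *)
Fixpoint wprod (x : R) (n : nat) : R :=
  match n with
  | O => 1
  | S n' => wprod x n' * (INR (S n') / (x + INR (S n')))
  end.

Lemma wprod_S (x : R) (n : nat) :
  wprod x (S n) = wprod x n * (INR (S n) / (x + INR (S n))).
Proof. reflexivity. Qed.

Lemma wprod_pos (x : R) (n : nat) : 0 < x -> 0 < wprod x n.
Proof.
  intros Hx; induction n as [|n IH]; [simpl; lra |].
  rewrite wprod_S.
  assert (H0 : 0 < INR (S n)) by (apply lt_0_INR; lia).
  apply Rmult_lt_0_compat; [exact IH | apply Rdiv_lt_0_compat; lra].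
Qed.

Lemma wprod_le (x y : R) (n : nat) : 0 < x -> x <= y -> wprod y n <= wprod x n.
Proof.
  intros Hx Hxy; induction n as [|n IH]; [simpl; lra |].
  rewrite !wprod_S.
  assert (H0 : 0 < INR (S n)) by (apply lt_0_INR; lia).
  apply Rmult_le_compat.
  - apply Rlt_le, wprod_pos; lra.
  - apply Rlt_le, Rdiv_lt_0_compat; lra.
  - exact IH.
  - apply Rmult_le_compat_l; [lra |]; apply Rinv_le_contravar; lra.
Qed.

Lemma wprod_le_1 (x : R) (n : nat) : 0 < x -> wprod x n <= 1.
Proof.
  intros Hx; induction n as [|n IH]; [simpl; lra |].
  rewrite wprod_S.
  assert (H0 : 0 < INR (S n)) by (apply lt_0_INR; lia).
  assert (Hw := wprod_pos x n Hx).
  assert (INR (S n) / (x + INR (S n)) <= 1)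
    by (apply Rmult_le_reg_r with (x + INR (S n)); [lra | field_simplify; lra]).
  nra.
Qed.

(** Squaring keeps the n^(-1/2) decay rational; the induction step reduces to (n+1)(n+2) <=
    (n+3/2)^2. *)
Lemma wprod_half_sqr (n : nat) : wprod (/ 2) n ^ 2 <= / (INR n + 1).
Proof.
  induction n as [|n IH]; [simpl; lra |].
  rewrite wprod_S, Rpow_mult_distr, S_INR.
  assert (H0 := pos_INR n).
  apply Rle_trans with (/ (INR n + 1) * ((INR n + 1) / (/ 2 + (INR n + 1))) ^ 2).
  - apply Rmult_le_compat_r; [apply pow2_ge_0 | exact IH].
  - replace (/ (INR n + 1) * ((INR n + 1) / (/ 2 + (INR n + 1))) ^ 2)
      with ((INR n + 1) / (INR n + 3 / 2) ^ 2) by (field; lra).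
    apply Rmult_le_reg_r with ((INR n + 3 / 2) ^ 2 * (INR n + 1 + 1)); [nra |].
    field_simplify; nra.
Qed.

Lemma is_lim_seq_wprod (x : R) : / 2 <= x -> is_lim_seq (wprod x) 0.
Proof.
  intros Hx.
  assert (H2 : is_lim_seq (fun n => sqrt (/ (INR n + 1))) 0).
  { rewrite <- sqrt_0.
    apply is_lim_seq_continuous; [apply continuity_pt_sqrt; lra |].
    apply (is_lim_seq_inv _ p_infty); [| discriminate].
    apply is_lim_seq_ext with (fun n => INR (S n)); [apply S_INR |].
    apply (is_lim_seq_incr_1 INR), is_lim_seq_INR. }
  apply is_lim_seq_le_le with
    (u := fun _ => 0) (w := fun n => sqrt (/ (INR n + 1)));
    [| apply is_lim_seq_const | exact H2].
  intro n; split; [apply Rlt_le, wprod_pos; lra |].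
  apply Rle_trans with (wprod (/ 2) n); [apply wprod_le; lra |].
  assert (Hw := wprod_pos (/ 2) n ltac:(lra)).
  rewrite <- (sqrt_pow2 (wprod (/ 2) n)) by lra.
  apply sqrt_le_1_alt, wprod_half_sqr.
Qed.

(** * Summing the transformed series by shifting x *)

(* Equal to [k! / ((k+1) (x)_(k+1))] in terms of the rising factorial [(x)_k]. *)
Definition bterm (x : R) (k : nat) : R := wprod x k / (INR (S k) * x).

Lemma wprod_shift (x : R) (n : nat) :
  0 < x -> wprod (x + 1) n = wprod x n * ((x + 1) / (x + INR (S n))).
Proof.
  intros Hx; induction n as [|n IH].
  - simpl; field; lra.
  - rewrite !wprod_S, IH, !S_INR.
    assert (H0 := pos_INR n); field; lra.
Qed.

(** Termwise, [bterm x k - bterm (x + 1) k] equals [(wprod x k - wprod x (S k)) / x ^ 2], which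
    telescopes in k. *)
Lemma psum_bterm_shift (x : R) (n : nat) :
  0 < x ->
  psum (bterm x) n = (1 - wprod x n) / x ^ 2 + psum (bterm (x + 1)) n.
Proof.
  intros Hx; induction n as [|n IH]; [simpl; field; lra |].
  rewrite !psum_S, IH; unfold bterm.
  rewrite wprod_shift by exact Hx.
  rewrite wprod_S, !S_INR.
  assert (H0 := pos_INR n); field; lra.
Qed.

Lemma psum_bterm_shifts (x : R) (n p : nat) :
  0 < x ->
  psum (bterm x) n
  = psum (fun j => (1 - wprod (x + INR j) n) / (x + INR j) ^ 2) p
    + psum (bterm (x + INR p)) n.
Proof.
  intros Hx; induction p as [|p IH]; [simpl; rewrite Rplus_0_r; ring |].
  assert (H0 := pos_INR p).
  rewrite IH, psum_S, (psum_bterm_shift (x + INR p)), S_INR by lra.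
  rewrite (Rplus_assoc x); ring.
Qed.

(** This crude bound serves to kill the remainder after p shifts: with n fixed, n / (x+p) tends to
    0. *)
Lemma psum_bterm_bounds (x : R) (n : nat) :
  0 < x -> 0 <= psum (bterm x) n <= INR n / x.
Proof.
  intros Hx.
  assert (Hb : forall k, 0 <= bterm x k <= / x).
  { intro k; unfold bterm.
    assert (H0 : 1 <= INR (S k)) by (apply (le_INR 1); lia).
    assert (Hw := wprod_pos x k Hx).
    assert (Hw1 := wprod_le_1 x k Hx).
    split.
    - apply Rlt_le, Rdiv_lt_0_compat; nra.
    - apply Rmult_le_reg_r with (INR (S k) * x); [nra |].
      field_simplify; lra. }
  split.
  - replace 0 with (psum (fun _ => 0) n) by (rewrite psum_const; ring).
    apply psum_le; intros; apply Hb.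
  - unfold Rdiv; rewrite <- psum_const; apply psum_le; intros; apply Hb.
Qed.

(** Here n stays fixed and p tends to infinity in [psum_bterm_shifts], so no interchange of infinite
    sums arises. *)
Lemma psum_bterm_tail_bounds (x G : R) (n : nat) :
  0 < x -> is_series (fun j => / (x + INR j) ^ 2) G ->
  (1 - wprod x n) * G <= psum (bterm x) n <= G.
Proof.
  intros Hx HG; apply is_series_psum in HG.
  assert (Hj : forall j, 0 < / (x + INR j) ^ 2).
  { intro j; apply Rinv_0_lt_compat, pow_lt; assert (H0 := pos_INR j); lra. }
  split.
  (* Lower bound: drop the nonnegative remainder and replace each [wprod (x + INR j) n] by the
     larger [wprod x n]. *)
  - apply (is_lim_seq_le
             (fun p => (1 - wprod x n) * psum (fun j => / (x + INR j) ^ 2) p)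
             (fun _ => psum (bterm x) n) ((1 - wprod x n) * G) (psum (bterm x) n)).
    + intro p; assert (H0 := pos_INR p).
      rewrite (psum_bterm_shifts x n p Hx), <- psum_scal.
      assert (H1 := psum_bterm_bounds (x + INR p) n ltac:(lra)).
      enough (psum (fun j => (1 - wprod x n) * / (x + INR j) ^ 2) p <=
              psum (fun j => (1 - wprod (x + INR j) n) / (x + INR j) ^ 2) p)
        by lra.
      apply psum_le; intros j _.
      apply Rmult_le_compat_r; [apply Rlt_le, Hj |].
      assert (H2 := wprod_le x (x + INR j) n Hx
                      ltac:(assert (H3 := pos_INR j); lra)).
      lra.
    + apply (is_lim_seq_scal_l _ _ (Finite G)), HG.
    + apply is_lim_seq_const.
  (* Upper bound: each numerator is at most 1, and the remainder is at most n / (x+p). *)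
  - apply (is_lim_seq_le (fun _ => psum (bterm x) n)
             (fun p => psum (fun j => / (x + INR j) ^ 2) p + INR n * / (x + INR p))
             (psum (bterm x) n) G).
    + intro p; assert (H0 := pos_INR p).
      rewrite (psum_bterm_shifts x n p Hx).
      apply Rplus_le_compat; [| apply psum_bterm_bounds; lra].
      apply psum_le; intros j _.
      assert (H1 := wprod_pos (x + INR j) n
                      ltac:(assert (H3 := pos_INR j); lra)).
      specialize (Hj j); unfold Rdiv; nra.
    + apply is_lim_seq_const.
    + replace (Finite G) with (Finite (G + INR n * 0)) by (f_equal; ring).
      apply is_lim_seq_plus'; [exact HG |].
      apply (is_lim_seq_scal_l _ _ (Finite 0)).
      apply (is_lim_seq_inv _ p_infty); [| discriminate].
      apply (is_lim_seq_plus (fun _ => x) INR x p_infty);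
        [apply is_lim_seq_const | apply is_lim_seq_INR | reflexivity].
Qed.

Lemma is_series_bterm (x G : R) :
  / 2 <= x -> is_series (fun j => / (x + INR j) ^ 2) G -> is_series (bterm x) G.
Proof.
  intros Hx HG; apply is_series_psum.
  apply is_lim_seq_le_le with (u := fun n => (1 - wprod x n) * G) (w := fun _ => G).
  - intro n; apply psum_bterm_tail_bounds; [lra | exact HG].
  - replace (Finite G) with (Finite ((1 - 0) * G)) by (f_equal; ring).
    apply (is_lim_seq_scal_r _ G (Finite (1 - 0))).
    apply is_lim_seq_minus'; [apply is_lim_seq_const | apply is_lim_seq_wprod, Hx].
  - apply is_lim_seq_const.
Qed.

(** Since 1/(m + 1/2 + j)^2 = 4/(2(m+j) + 1)^2, this is four times the tail of the odd series from
    index m on. *)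
Lemma is_series_half_shift (m : nat) :
  is_series (fun j => / (INR m + / 2 + INR j) ^ 2)
    (PI ^ 2 / 2 - 4 * psum (fun k => / (2 * INR k + 1) ^ 2) m).
Proof.
  apply is_series_psum.
  set (a := fun k => / (2 * INR k + 1) ^ 2).
  apply is_lim_seq_ext with (fun p => 4 * (psum a (p + m) - psum a m)).
  - intro p; rewrite Nat.add_comm, psum_add.
    replace (psum a m + _ - psum a m) with (psum (fun k => a (m + k)%nat) p) by ring.
    rewrite <- psum_scal; apply psum_ext; intros k _; unfold a.
    rewrite plus_INR.
    assert (H0 := pos_INR m); assert (H1 := pos_INR k); field; lra.
  - replace (Finite (PI ^ 2 / 2 - 4 * psum a m))
      with (Finite (4 * (PI ^ 2 / 8 - psum a m))) by (f_equal; field).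
    apply (is_lim_seq_scal_l _ 4 (Finite (PI ^ 2 / 8 - psum a m))).
    apply is_lim_seq_minus'; [| apply is_lim_seq_const].
    apply (is_lim_seq_incr_n (psum a)), is_series_psum, is_series_inv_odd2.
Qed.

(** * Odd harmonic sums, binomial ratios and the summand *)

Lemma odd_harmonic_psum (m : nat) :
  odd_harmonic 2 m = psum (fun k => / (2 * INR k + 1) ^ 2) m.
Proof.
  (* The case m = 0 is separate because [sum_n] always has at least one term. *)
  unfold odd_harmonic; destruct m as [|m]; [rewrite sum_n_m_zero; [reflexivity | lia] |].
  rewrite <- sum_n_psum; unfold sum_n; rewrite <- sum_n_m_S.
  apply sum_n_m_ext; intro k.
  rewrite S_INR; unfold Rdiv; rewrite Rmult_1_l; do 2 f_equal; ring.
Qed.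

Lemma binomial_pos (n k : nat) : 0 < Binomial.C n k.
Proof.
  unfold Binomial.C; apply Rdiv_lt_0_compat;
    [| apply Rmult_lt_0_compat]; apply INR_fact_lt_0.
Qed.

Lemma central_binomial_S (n : nat) :
  Binomial.C (2 * S n) (S n)
  = Binomial.C (2 * n) n * (2 * (2 * INR n + 1) / (INR n + 1)).
Proof.
  unfold Binomial.C.
  replace (2 * S n - S n)%nat with (S n) by lia.
  replace (2 * n - n)%nat with n by lia.
  replace (2 * S n)%nat with (S (S (2 * n))) by lia.
  rewrite !fact_simpl, !mult_INR, !S_INR, mult_INR; change (INR 2) with 2.
  assert (H0 := pos_INR n); assert (H1 := INR_fact_neq_0 n).
  field; split; [lra | exact H1].
Qed.

Lemma binomial_add_S (n m : nat) :
  Binomial.C (S n + m) m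
  = Binomial.C (n + m) m * ((INR n + 1 + INR m) / (INR n + 1)).
Proof.
  unfold Binomial.C.
  replace (S n + m - m)%nat with (S n) by lia.
  replace (n + m - m)%nat with n by lia.
  simpl (S n + m)%nat.
  rewrite !fact_simpl, !mult_INR, !S_INR, plus_INR.
  assert (H0 := pos_INR n); assert (H1 := INR_fact_neq_0 n).
  assert (H2 := INR_fact_neq_0 m).
  field; repeat split; (assumption || lra).
Qed.

(** Both sides agree at k = 0 and have the same ratio of consecutive terms, (k+1)^2 / ((k+2)(k + m +
    3/2)). *)
Lemma summand_eq_bterm (m k : nat) :
  2 ^ (2 * S k)
  / (INR (S k) ^ 2 * Binomial.C (2 * (S k + m)) (S k + m) * Binomial.C (S k + m) m)
  = / Binomial.C (2 * m) m * bterm (INR m + / 2) k.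
Proof.
  assert (HB : forall n p, Binomial.C n p <> 0)
    by (intros; apply Rgt_not_eq, binomial_pos).
  assert (Hm := pos_INR m).
  unfold bterm.
  induction k as [|k IH].
  - rewrite (binomial_add_S 0 m).
    change (1 + m)%nat with (S m); rewrite central_binomial_S.
    replace (Binomial.C (0 + m) m) with 1
      by (unfold Binomial.C; rewrite Nat.sub_diag; simpl; field; apply INR_fact_neq_0).
    simpl; field; repeat split; (apply HB || lra).
  - assert (Hk := pos_INR k).
    assert (HA := HB (2 * (S k + m))%nat (S k + m)%nat).
    assert (HC := HB (S k + m)%nat m).
    assert (HD := HB (2 * m)%nat m).
    change (S (S k) + m)%nat with (S (S k + m)).
    rewrite central_binomial_S.
    change (S (S k + m)) with (S (S k) + m)%nat.
    rewrite (binomial_add_S (S k) m).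
    replace (2 * S (S k))%nat with (2 * S k + 2)%nat by lia.
    rewrite pow_add.
    rewrite wprod_S, plus_INR, !S_INR; rewrite S_INR in IH.
    set (A := Binomial.C (2 * (S k + m)) (S k + m)) in *.
    set (B := Binomial.C (S k + m) m) in *.
    set (D := Binomial.C (2 * m) m) in *.
    set (w := wprod (INR m + / 2) k) in *.
    (* Writing the power of 2 as the previous summand times its denominator makes the left side of
       [IH] appear. *)
    replace (2 ^ (2 * S k))
      with (2 ^ (2 * S k) / ((INR k + 1) ^ 2 * A * B) * ((INR k + 1) ^ 2 * A * B))
      by (field; repeat split; (assumption || lra)).
    rewrite IH; field; repeat split; (assumption || lra).
Qed.

Theorem theorem2 :
  (forall m : nat,
     is_series_from1
       (fun n : nat =>
          2 ^ (2 * n)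
          / (INR n ^ 2 * Binomial.C (2 * (n + m)) (n + m) * Binomial.C (n + m) m))
       (1 / Binomial.C (2 * m) m * (3 * zeta 2 - 4 * odd_harmonic 2 m)))
  /\
  is_series_from1
    (fun n : nat => 2 ^ (2 * n) / (INR n ^ 2 * Binomial.C (2 * n) n))
    (PI ^ 2 / 2).
Proof.
  assert (H : forall m : nat,
     is_series_from1
       (fun n : nat =>
          2 ^ (2 * n)
          / (INR n ^ 2 * Binomial.C (2 * (n + m)) (n + m) * Binomial.C (n + m) m))
       (1 / Binomial.C (2 * m) m * (3 * zeta 2 - 4 * odd_harmonic 2 m))).
  { intro m; unfold is_series_from1.
    eapply is_series_ext; [intro k; symmetry; apply summand_eq_bterm |].
    unfold Rdiv; rewrite Rmult_1_l.
    apply (@is_series_scal_l R_AbsRing R_NormedModule (/ Binomial.C (2 * m) m)),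
      is_series_bterm;
      [assert (H0 := pos_INR m); lra |].
    rewrite zeta_2, odd_harmonic_psum.
    replace (3 * (PI ^ 2 / 6)) with (PI ^ 2 / 2) by field.
    apply is_series_half_shift. }
  split; [exact H |].
  assert (HC : forall n, Binomial.C n 0 = 1).
  { intro n; unfold Binomial.C; rewrite Nat.sub_0_r; simpl.
    field; apply INR_fact_neq_0. }
  specialize (H 0%nat); unfold is_series_from1 in *.
  rewrite HC, odd_harmonic_psum, zeta_2 in H.
  (* The factor [0] is the empty odd harmonic sum, and [1 / 1] comes from binom(0, 0) = 1. *)
  replace (PI ^ 2 / 2) with (1 / 1 * (3 * (PI ^ 2 / 6) - 4 * 0)) by field.
  eapply is_series_ext; [| exact H].
  intro k; cbv beta; rewrite HC, Nat.add_0_r, Rmult_1_r; reflexivity.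
Qed.
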